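(* Let $f$ be a Boolean function. Then $f$ is join-irreducible if and only if $\operatorname{ess} f\ge 2$ and $C_f$ is an equivalence class of $\approx$. Furthermore, if $\operatorname{gap} f=2$, then $f$ is join-irreducible and $C_f=[\operatorname{Ess} f]^2$.
   Context: A Boolean function of arity $n\ge1$ is a map $f\colon\{0,1\}^n\to\{0,1\}$. For $g$ of arity $m$ and $f$ of arity $n$, $g\le f$ if there is $\sigma\colon\{1,\dots,n\}\to\{1,\dots,m\}$ with $g(a_1,\dots,a_m)=f(a_{\sigma(1)},\dots,a_{\sigma(n)})$ for all $a_i\in\{0,1\}$; $f\equiv g$ means $f\le g$ and $g\le f$; $g<f$ means $g\le f$ and $f\not\le g$. The function $f$ is join-irreducible if there is $f'<f$ such that every $g<f$ satisfies $g\le f'$ (equivalently, the $\equiv$-class of $f$ has exactly one lower cover in the poset of $\equiv$-classes ordered by $\le$). The variable $x_i$ is essential in $f$ if for some values of the other arguments $x\mapsto f(a_1,\dots,a_{i-1},x,a_{i+1},\dots,a_n)$ is nonconstant; $\operatorname{Ess} f\subseteq\{1,\dots,n\}$ is the set of indices of essential variables, $\operatorname{ess} f=|\operatorname{Ess} f|$, and $[\operatorname{Ess} f]^2$ is the set of 2-element subsets of $\operatorname{Ess} f$. The arity gap is $\operatorname{gap} f=\min\{\operatorname{ess} f-\operatorname{ess} g: g<f\}$. For $i,j\in\{1,\dots,n\}$, $f_{i=j}$ denotes the function obtained by identifying $x_i$ with $x_j$: $f_{i=j}(a_1,\dots,a_n)=f(a_1,\dots,a_{i-1},a_j,a_{i+1},\dots,a_n)$.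 On $[\operatorname{Ess} f]^2$ define $\{i,j\}\approx\{i',j'\}$ iff $f_{i=j}\equiv f_{i'=j'}$ (an equivalence relation). Let $C_f=\{\{i,j\}\in[\operatorname{Ess} f]^2:\operatorname{ess} f_{i=j}=\operatorname{ess} f-\operatorname{gap} f\}$. *)

(* Defs.v *)
From mathcomp Require Import all_boot.
From mathcomp Require Import boolp classical_sets.

Set Implicit Arguments.
Unset Strict Implicit.
Unset Printing Implicit Defensive.

(* Arities are required to be positive; the type itself allows n = 0, so every
   quantification over Boolean functions below carries a hypothesis 0 < n. *)
Definition boolfun (n : nat) : Type := {ffun 'I_n -> bool} -> bool.

Definition upd n (a : {ffun 'I_n -> bool}) (i : 'I_n) (x : bool) :
    {ffun 'I_n -> bool} :=
  [ffun k => if k == i then x else a k].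

Definition minor m n (g : boolfun m) (f : boolfun n) : bool :=
  [exists s : {ffun 'I_n -> 'I_m},
    [forall a : {ffun 'I_m -> bool}, g a == f [ffun i => a (s i)]]].

Definition minor_equiv m n (f : boolfun m) (g : boolfun n) : bool :=
  minor f g && minor g f.

Definition strict_minor m n (g : boolfun m) (f : boolfun n) : bool :=
  minor g f && ~~ minor f g.

Definition join_irreducible n (f : boolfun n) : Prop :=
  exists (m : nat) (f' : boolfun m),
    [/\ 0 < m, strict_minor f' f &
        forall (k : nat) (g : boolfun k),
          0 < k -> strict_minor g f -> minor g f'].

Definition essential n (f : boolfun n) (i : 'I_n) : bool :=
  [exists a : {ffun 'I_n -> bool}, [exists x : bool, [exists y : bool,
    f (upd a i x) != f (upd a i y)]]].

Definition Ess n (f : boolfun n) : {set 'I_n} := [set i | essential f i]%SET.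

Definition ess n (f : boolfun n) : nat := #|Ess f|.

(* A strict minor g of f has ess g < ess f, so the subtraction is exact. *)
Definition gap_values n (f : boolfun n) : set nat :=
  [set d | exists (m : nat) (g : boolfun m),
    [/\ 0 < m, strict_minor g f & d = ess f - ess g]]%classic.

(* The minimum of gap_values f. This set is empty iff ess f < 2, and then
   gap f takes the default value 0, which is never a genuine gap. *)
Definition gap n (f : boolfun n) : nat :=
  xget 0 [set d | gap_values f d /\
                  forall d', gap_values f d' -> d <= d']%classic.

Definition identify n (f : boolfun n) (i j : 'I_n) : boolfun n :=
  fun a => f (upd a i (a j)).

Definition Ess2 n (f : boolfun n) : {set {set 'I_n}} :=
  [set p : {set 'I_n} | (p \subset Ess f) && (#|p| == 2)]%SET.

(* Since identify f i j and identify f j i are equivalent, the relations below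
   do not depend on the order in which the elements of a pair are listed. *)
Definition approx n (f : boolfun n) : rel {set 'I_n} := fun p q =>
  [exists i, exists j, exists i', exists j',
    [&& p == [set i; j]%SET, q == [set i'; j']%SET &
        minor_equiv (identify f i j) (identify f i' j')]].

Definition Cset n (f : boolfun n) : {set {set 'I_n}} :=
  [set p in Ess2 f | [exists i, exists j,
    (p == [set i; j]%SET) && (ess (identify f i j) == ess f - gap f)]]%SET.

(* Main.v *)
(** Every strict minor of f lies below some f_{i=j} with i and j essential, so
    f is join-irreducible iff one of these identifications is greatest among
    them.  Everything rests on the following fact: if f_{i=j} is maximal among
    them and has at least two essential variables fewer than f, then it is
    equivalent to every f_{k=l}.  To see this, call an essential variable m
    universal when f_{i=j} <= f_{m=u} for all u.  A variable lost by
    an identification may be merged with any other one, so by maximality every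
    f_{k=l} >= f_{i=j} loses a universal variable other than k.  Suppose that v
    is not universal.  Then for each universal i, f_{i=v} loses a universal
    variable m, that is, f does not depend on x_m as long as x_i = x_v.  In a
    minimal nonempty set Z of universal variables in which such an m can always
    be found, the equality x_i = x_v propagates to all of Z, so f only sees
    whether some coordinate in Z equals x_v.  Hence identifying two variables i
    and k in Z loses no variable other than i and v, whereas it should lose a
    universal variable other than i. *)
Require Import Defs.
From mathcomp Require Import all_boot.
From mathcomp Require boolp classical_sets.

Set Implicit Arguments.
Unset Strict Implicit.
Unset Printing Implicit Defensive.

Local Notation point n := {ffun 'I_n -> bool}.

Lemma upd_id n (a : point n) i x : a i = x -> upd a i x = a.
Proof. by move=> <-; apply/ffunP=> k; rewrite ffunE; case: eqP => // ->. Qed.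

Section EssentialVariables.

Variables (n : nat) (f : boolfun n).

Lemma nonessential_upd i a x : i \notin Ess f -> f (upd a i x) = f a.
Proof.
rewrite inE => /existsPn /(_ a) /existsPn /(_ x) /existsPn /(_ (a i)).
by rewrite negbK => /eqP ->; rewrite upd_id.
Qed.

Lemma essentialP i :
  reflect (exists a x, f (upd a i x) != f a) (i \in Ess f).
Proof.
apply: (iffP idP) => [|[a [x]]]; last first.
  by apply: contraNT => /nonessential_upd ->.
rewrite inE => /existsP[a /existsP[x /existsP[y fxy]]].
exists (upd a i y), x; rewrite [upd _ i x](_ : _ = upd a i x) //.
by apply/ffunP=> k; rewrite !ffunE; case: eqP.
Qed.

Lemma eq_on_Ess (a b : point n) : {in Ess f, a =1 b} -> f a = f b.
Proof.
move=> ab; pose c (s : seq 'I_n) := [ffun k => if k \in s then b k else a k].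
have fc s : f (c s) = f a.
  elim: s => [|i s IHs]; first by congr (f _); apply/ffunP=> k; rewrite ffunE.
  have -> : c (i :: s) = upd (c s) i (b i).
    by apply/ffunP=> k; rewrite !ffunE inE; case: eqP => [->|].
  have [fi|/nonessential_upd -> //] := boolP (i \in Ess f).
  by rewrite upd_id // ffunE ab // if_same.
rewrite -(fc (enum 'I_n)); congr (f _).
by apply/ffunP=> k; rewrite ffunE mem_enum.
Qed.

End EssentialVariables.

Definition minor_via m n (s : 'I_n -> 'I_m) (g : boolfun m) (f : boolfun n) :=
  forall a, g a = f [ffun i => a (s i)].

Lemma minorP m n (g : boolfun m) (f : boolfun n) :
  reflect (exists s, minor_via s g f) (minor g f).
Proof.
apply: (iffP existsP) => [[s /forallP gs]|[s gs]].
  by exists s => a; apply/eqP.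
exists (finfun s); apply/forallP=> a; rewrite gs; apply/eqP; congr (f _).
by apply/ffunP=> i; rewrite !ffunE.
Qed.

Lemma minor_refl n (f : boolfun n) : minor f f.
Proof.
apply/minorP; exists id => a; congr (f _).
by apply/ffunP=> i; rewrite ffunE.
Qed.

Lemma minor_trans m n p (g : boolfun n) (f : boolfun m) (h : boolfun p) :
  minor f g -> minor g h -> minor f h.
Proof.
move=> /minorP[s fs] /minorP[t gt]; apply/minorP; exists (s \o t) => a.
by rewrite fs gt; congr (h _); apply/ffunP=> i; rewrite !ffunE.
Qed.

Lemma minor_equiv_sym m n (f : boolfun m) (g : boolfun n) :
  minor_equiv f g = minor_equiv g f.
Proof. exact: andbC. Qed.

Lemma minor_equiv_trans m n p (g : boolfun n) (f : boolfun m) (h : boolfun p) :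
  minor_equiv f g -> minor_equiv g h -> minor_equiv f h.
Proof.
move=> /andP[fg gf] /andP[gh hg].
by rewrite /minor_equiv (minor_trans fg gh) (minor_trans hg gf).
Qed.

Section MinorsAndEssentialVariables.

Variables (m n : nat) (g : boolfun m) (f : boolfun n).

Lemma Ess_minor_via s : minor_via s g f -> Ess g \subset s @: Ess f.
Proof.
move=> gs; apply/subsetP=> j; apply: contraTT => js; apply/negP.
case/essentialP=> a [x /eqP[]]; rewrite !gs; apply: eq_on_Ess => i fi.
rewrite !ffunE; case: eqP => // si.
by case/imsetP: js; exists i.
Qed.

Lemma ess_minor : minor g f -> ess g <= ess f.
Proof.
case/minorP=> s /Ess_minor_via/subset_leq_card/leq_trans; apply.
exact: leq_imset_card.
Qed.

Hypothesis n_gt0 : 0 < n.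

Lemma minor_via_inj s :
  minor_via s g f -> {in Ess f &, injective s} -> minor f g.
Proof.
move=> gs s_inj; apply/minorP.
pose t j := odflt (Ordinal n_gt0) [pick i in Ess f | s i == j].
exists t => a; rewrite gs; apply: eq_on_Ess => i fi; rewrite !ffunE /t.
case: pickP => [k /andP[fk /eqP ski]|/(_ i)] /=; last by rewrite fi eqxx.
by rewrite (s_inj k i).
Qed.

Lemma minor_ess_ge : minor g f -> ess f <= ess g -> minor f g.
Proof.
move=> /minorP[s gs] le_fg; apply: (minor_via_inj gs).
apply/imset_injP; rewrite eqn_leq leq_imset_card.
exact: leq_trans le_fg (subset_leq_card (Ess_minor_via gs)).
Qed.

Lemma strict_minor_ess : strict_minor g f -> ess g < ess f.
Proof.
by case/andP=> gf; rewrite ltnNge; apply: contra => /minor_ess_ge ->.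
Qed.

End MinorsAndEssentialVariables.

Lemma minor_equiv_ess m n (g : boolfun m) (f : boolfun n) :
  minor_equiv g f -> ess g = ess f.
Proof. by case/andP=> gf fg; apply/eqP; rewrite eqn_leq !ess_minor. Qed.

Lemma set2_eqP (T : finType) (i j k l : T) :
  reflect ((k = i /\ l = j) \/ (k = j /\ l = i)) ([set i; j] == [set k; l]).
Proof.
apply: (iffP eqP) => [eq_p|[[-> ->]|[-> ->]]]; rewrite 1?setUC //.
have := set21 k l; have := set22 k l; have := set21 i j; have := set22 i j.
rewrite -eq_p {1 2}eq_p => /set2P jkl /set2P ikl /set2P lij /set2P kij.
by case: kij lij jkl ikl => -> [] -> [] ? [] ?; auto.
Qed.

Lemma Ess2_set2 n (f : boolfun n) i j :
  ([set i; j] \in Ess2 f) = [&& i \in Ess f, j \in Ess f & i != j].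
Proof. by rewrite inE subUset !sub1set cards2 eqSS eqb1 andbA. Qed.

Lemma Ess2P n (f : boolfun n) p :
  reflect (exists i j, p = [set i; j] /\ [set i; j] \in Ess2 f) (p \in Ess2 f).
Proof.
apply: (iffP idP) => [pf|[i [j [-> //]]]].
have /setIdP[_ /cards2P[i [j [_ pE]]]] := pf.
by exists i, j; rewrite -pE.
Qed.

Lemma ess_gt1P n (f : boolfun n) :
  reflect (exists i j, [set i; j] \in Ess2 f) (1 < ess f).
Proof.
apply: (iffP card_gt1P) => [[i [j [fi fj ij]]]|[i [j]]].
  by exists i, j; rewrite Ess2_set2 fi fj.
by rewrite Ess2_set2 => /and3P[]; exists i, j.
Qed.

Definition redirect n (i j k : 'I_n) : 'I_n := if k == i then j else k.

Section Identification.

Variables (n : nat) (f : boolfun n).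

Lemma identify_id i k (a : point n) : a i = a k -> identify f i k a = f a.
Proof. by move=> aik; rewrite /identify upd_id. Qed.

Lemma identify_via i j : minor_via (redirect i j) (identify f i j) f.
Proof.
move=> a; congr (f _); apply/ffunP=> k; rewrite !ffunE /redirect.
by case: eqP.
Qed.

Lemma minor_via_identify m (g : boolfun m) s i j :
  minor_via s g f -> s i = s j -> minor g (identify f i j).
Proof.
move=> gs sij; apply/minorP; exists s => a.
by rewrite gs identify_id // !ffunE sij.
Qed.

Lemma identify_sym i j : minor (identify f i j) (identify f j i).
Proof.
apply: minor_via_identify (identify_via i j) _.
by rewrite /redirect eqxx if_same.
Qed.

Lemma identify_set2 i j k l : [set i; j] = [set k; l] ->
  minor_equiv (identify f i j) (identify f k l).
Proof.
move/eqP/set2_eqP=> [[-> ->]|[-> ->]]; rewrite /minor_equiv.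
  by rewrite minor_refl.
by rewrite !identify_sym.
Qed.

Lemma Ess_identify i j :
  i != j -> j \in Ess f -> Ess (identify f i j) \subset Ess f :\ i.
Proof.
move=> ij fj; apply: subset_trans (Ess_minor_via (identify_via i j)) _.
apply/subsetP=> _ /imsetP[k fk ->]; rewrite in_setD1 /redirect.
by case: (eqVneq k i) => [_|-> //]; rewrite eq_sym ij.
Qed.

Lemma identify_strict i j :
  [set i; j] \in Ess2 f -> strict_minor (identify f i j) f.
Proof.
rewrite Ess2_set2 => /and3P[fi fj ij]; apply/andP; split.
  by apply/minorP; exists (redirect i j); apply: identify_via.
apply: contraTN (subset_leq_card (Ess_identify ij fj)) => /ess_minor.
by rewrite -ltnNge {1}/ess (cardsD1 i) fi.
Qed.

Lemma strict_minor_identify m (g : boolfun m) : 0 < n -> strict_minor g f ->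
  exists i j, [set i; j] \in Ess2 f /\ minor g (identify f i j).
Proof.
move=> n_gt0 /andP[/minorP[s gs]].
have [s_inj|] := boolP (dinjectiveb s (Ess f)).
  by rewrite (minor_via_inj n_gt0 gs) //; apply/dinjectiveP.
case/dinjectivePn=> i fi [j]; rewrite inE => /andP[ji fj] sij _.
exists i, j; rewrite Ess2_set2 fi fj eq_sym; split=> //.
exact: minor_via_identify gs sij.
Qed.

Lemma identify_lost i j :
  i \in Ess f -> (ess (identify f i j)).+1 < ess f ->
  exists m, [/\ m \in Ess f, m != i & m \notin Ess (identify f i j)].
Proof.
move=> fi; rewrite /ess (cardsD1 i (Ess f)) fi ltnS => lt_card.
have /subsetPn[m] : ~~ (Ess f :\ i \subset Ess (identify f i j)).
  by apply: contraL lt_card => /subset_leq_card; rewrite -leqNgt.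
by rewrite in_setD1 => /andP[mi fm] ?; exists m.
Qed.

Lemma minor_identify_lost i j m u : m != i -> m \notin Ess (identify f i j) ->
  minor (identify f i j) (identify f m u).
Proof.
move=> mi lost; pose r := redirect i j.
apply: (@minor_via_identify _ _ (redirect m (r u) \o r)) => [a|].
  rewrite -(nonessential_upd a (a (r u)) lost) identify_via; congr (f _).
  by apply/ffunP=> k; rewrite !ffunE /= /r /redirect [RHS]fun_if.
by rewrite /= /r /redirect (negPf mi) eqxx if_same.
Qed.

Lemma lost_upd i v m (a : point n) x :
  m \notin Ess (identify f i v) -> m != i -> m != v -> a i = a v ->
  f (upd a m x) = f a.
Proof.
move=> lost mi mv aiv; rewrite -(identify_id aiv) -(nonessential_upd a x lost).
by rewrite identify_id // !ffunE ![_ == m]eq_sym (negPf mi) (negPf mv).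
Qed.

End Identification.

Definition upd_set n (a : point n) (Z : {set 'I_n}) x : point n :=
  [ffun k => if k \in Z then x else a k].

Lemma upd_set_id n (a : point n) (Z : {set 'I_n}) x :
  {in Z, forall k, a k = x} -> upd_set a Z x = a.
Proof.
by move=> aZ; apply/ffunP=> k; rewrite ffunE; case: ifP => // /aZ ->.
Qed.

Lemma upd_set_upd n (a : point n) (Z : {set 'I_n}) i x y :
  i \in Z -> upd_set (upd a i x) Z y = upd_set a Z y.
Proof.
move=> iZ; apply/ffunP=> k; rewrite !ffunE.
by case: ifPn => // kZ; case: eqP => // ki; rewrite -ki (negPf kZ) in iZ.
Qed.

Lemma upd_upd_set n (a : point n) (Z : {set 'I_n}) i x y :
  i \notin Z -> upd (upd_set a Z y) i x = upd_set (upd a i x) Z y.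
Proof.
move=> iZ; apply/ffunP=> k; rewrite !ffunE.
by case: eqP => // ->; rewrite (negPf iZ).
Qed.

Section Absorption.

Variables (n : nat) (f : boolfun n) (v : 'I_n).

Definition absorbing (Z : {set 'I_n}) :=
  forall (a : point n) i, i \in Z -> a i = a v -> f a = f (upd_set a Z (a v)).

Section AbsorbingSet.

Variable Z : {set 'I_n}.
Hypotheses (vZ : v \notin Z) (absZ : absorbing Z).

Definition collapse (a : point n) : point n :=
  upd_set a Z (if [exists j in Z, a j == a v] then a v else ~~ a v).

Lemma absorbing_collapse a : f (collapse a) = f a.
Proof.
rewrite /collapse; case: ifPn => [/exists_inP[i iZ /eqP aiv]|/exists_inPn aZ].
  by rewrite -(absZ iZ).
by rewrite upd_set_id // => k /aZ; case: (a k) (a v) => [] [].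
Qed.

Lemma collapse_upd a u x :
  u \notin Z -> u != v -> collapse (upd a u x) = upd (collapse a) u x.
Proof.
move=> uZ uv; rewrite /collapse upd_upd_set // ffunE eq_sym (negPf uv).
congr (upd_set _ _ (if _ then _ else _)); apply: eq_existsb => j.
by rewrite ffunE; case: (eqVneq j u) => // ->; rewrite (negPf uZ).
Qed.

(* By [absorbing_collapse], f only takes these two values once the coordinates
   outside Z are fixed. *)
Lemma absorbing_upd_set_neq a u x : u \in Z -> f (upd a u x) != f a ->
  f (upd_set a Z (~~ a v)) != f (upd_set a Z (a v)).
Proof.
move=> uZ; apply: contraNN => /eqP eqf.
have fill y : f (upd_set a Z y) = f (upd_set a Z (a v)).
  by case: y (a v) eqf => [] [].
rewrite -absorbing_collapse -(absorbing_collapse a).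
by rewrite /collapse upd_set_upd // !fill.
Qed.

Lemma absorbing_Ess i k : i \in Z -> k \in Z ->
  Ess f :\: [set i; v] \subset Ess (identify f i k).
Proof.
move=> iZ kZ; apply/subsetP=> u; rewrite in_setD in_set2 negb_or.
case/andP=> /andP[ui uv] /essentialP[a [x fx]]; apply/essentialP.
have fill b y : identify f i k (upd_set b Z y) = f (upd_set b Z y).
  by rewrite identify_id // !ffunE iZ kZ.
have [uZ|uZ] := boolP (u \in Z); last first.
  exists (collapse a), x.
  by rewrite -collapse_upd // !fill !absorbing_collapse.
exists (upd_set a Z (~~ a v)), (a v).
rewrite fill eq_sym; apply: contra (absorbing_upd_set_neq uZ fx) => /eqP ->.
rewrite /identify; set b := upd (upd_set a Z _) u _; set c := upd b i _.
have vi : v != i by apply: contraNneq vZ => ->.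
have cu : c u = a v by rewrite !ffunE (negPf ui) eqxx.
have cv : c v = a v.
  by rewrite !ffunE (negPf vi) [v == u]eq_sym (negPf uv) (negPf vZ).
have cZ : upd_set c Z (a v) = upd_set a Z (a v).
  rewrite upd_set_upd // upd_set_upd //; apply/ffunP=> j.
  by rewrite !ffunE; case: ifP => // ->.
by rewrite (absZ uZ) cv ?cZ.
Qed.

End AbsorbingSet.

Definition loss_closed (Z : {set 'I_n}) : bool :=
  (Z != set0) &&
  [forall i in Z, exists m in Z, (m != i) && (m \notin Ess (identify f i v))].

Lemma minset_loss_exit (Z W : {set 'I_n}) : minset loss_closed Z ->
  W \proper Z -> W != set0 ->
  exists i m, [/\ i \in W, m \in Z :\: W & m \notin Ess (identify f i v)].
Proof.
case/minsetP=> /andP[_ /forall_inP closedZ] minZ properW W0.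
have sWZ := proper_sub properW.
have : ~~ loss_closed W.
  by apply: contraTN properW => closedW; rewrite (minZ W) ?properxx.
rewrite /loss_closed W0 => /forall_inPn[i iW /exists_inPn keptW].
have /exists_inP[m mZ /andP[mi lost]] := closedZ i (subsetP sWZ i iW).
exists i, m; rewrite in_setD mZ andbT; split=> //.
by apply/negP=> /keptW; rewrite mi lost.
Qed.

Lemma minset_absorbing (Z : {set 'I_n}) :
  v \notin Z -> minset loss_closed Z -> absorbing Z.
Proof.
move=> vZ minZ a i; have [N] := ubnP #|[set j in Z | a j != a v]|.
elim: N a => // N IHN a; rewrite ltnS => le_N iZ aiv.
(* If W is not all of Z, it can be enlarged: for some j in W, f_{j=v} loses a
   variable m in Z outside W, so a m may be reset to a v. *)
pose W := [set j in Z | a j == a v].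
have iW : i \in W by rewrite inE iZ aiv eqxx.
have sWZ : W \subset Z by apply/subsetP=> j; rewrite inE => /andP[].
have [eqWZ|neqWZ] := eqVneq W Z.
  by rewrite upd_set_id // => j; rewrite -eqWZ inE => /andP[_ /eqP].
have [||j [m [jW mZW lost]]] := minset_loss_exit minZ (W := W).
- by rewrite properEneq neqWZ.
- by apply/set0Pn; exists i.
have /setDP[mZ mW] := mZW; have mv : m != v by apply: contraNneq vZ => <-.
have neqW k : k \in W -> m != k by apply: contraTneq => <-.
have ajv : a j = a v by move: jW; rewrite inE => /andP[_ /eqP].
rewrite -(lost_upd (a v) lost) ?(neqW j jW) //.
have := IHN (upd a m (a v)); rewrite upd_set_upd // !ffunE ![_ == m]eq_sym.
rewrite (negPf mv) (negPf (neqW i iW)); apply=> //; apply: leq_trans le_N.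
apply: proper_card; apply/properP; split.
  apply/subsetP=> k; rewrite !inE !ffunE.
  by case: (k == m); rewrite ?eqxx ?andbF.
exists m; rewrite !inE ?ffunE ?eqxx ?andbF //.
by move: mW; rewrite inE mZ.
Qed.

Lemma loss_closed_identify (S : {set 'I_n}) : v \notin S -> loss_closed S ->
  exists i k, [/\ i \in S, k \in S, i != k &
    Ess f :\: [set i; v] \subset Ess (identify f i k)].
Proof.
move=> vS /minset_exists[Z minZ sZS].
have vZ : v \notin Z by apply: contra vS; apply: (subsetP sZS).
have /minsetP[/andP[/set0Pn[i iZ] /forall_inP/(_ i iZ)]] := minZ.
case/exists_inP=> k kZ /andP[ki _] _.
exists i, k; split; try exact: (subsetP sZS); first by rewrite eq_sym.
by apply: absorbing_Ess iZ kZ => //; apply: minset_absorbing.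
Qed.

End Absorption.

Definition maximal_identify n (f : boolfun n) i j := [set i; j] \in Ess2 f /\
  forall k l, [set k; l] \in Ess2 f ->
    minor (identify f i j) (identify f k l) ->
    minor (identify f k l) (identify f i j).

Lemma exists_maximal_identify n (f : boolfun n) i j : [set i; j] \in Ess2 f ->
  exists k l, maximal_identify f k l /\ minor (identify f i j) (identify f k l).
Proof.
move=> ij; pose above (q : 'I_n * 'I_n) :=
  ([set q.1; q.2] \in Ess2 f) && minor (identify f i j) (identify f q.1 q.2).
have above_ij : above (i, j) by rewrite /above ij minor_refl.
case: (@arg_maxnP _ (i, j) above (fun q => ess (identify f q.1 q.2)) above_ij).
case=> k l /andP[/= kl le_ij] max_kl; exists k, l; split=> //; split=> // k' l'.
move=> kl' le_kl; have n_gt0 : 0 < n := leq_ltn_trans (leq0n i) (ltn_ord i).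
apply: (minor_ess_ge n_gt0 le_kl).
by apply: (max_kl (k', l')); rewrite /above kl' (minor_trans le_ij).
Qed.

Section MaximalIdentification.

Variables (n : nat) (f : boolfun n) (i j : 'I_n).

Definition universal : {set 'I_n} := [set m in Ess f |
  [forall u, minor (identify f i j) (identify f m u)]].

Lemma universal_Ess m : m \in universal -> m \in Ess f.
Proof. by case/setIdP. Qed.

Lemma minor_universal m u : m \in universal ->
  minor (identify f i j) (identify f m u).
Proof. by case/setIdP=> _ /forallP. Qed.

Hypothesis max_ij : maximal_identify f i j.
Hypothesis deficient : (ess (identify f i j)).+1 < ess f.

Lemma lost_universal k l : [set k; l] \in Ess2 f ->
  minor (identify f i j) (identify f k l) ->
  exists m, [/\ m \in universal, m != k & m \notin Ess (identify f k l)].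
Proof.
move=> kl le_kl; have := kl; rewrite Ess2_set2 => /and3P[fk _ _].
have [|m [fm mk lost]] := @identify_lost _ f k l fk.
  apply: leq_ltn_trans deficient; rewrite ltnS ess_minor //.
  by case: max_ij => _; apply.
exists m; split=> //; rewrite inE fm; apply/forallP=> u.
by apply: minor_trans le_kl _; apply: minor_identify_lost lost.
Qed.

Lemma loss_closed_universal v :
  v \in Ess f -> v \notin universal -> loss_closed f v universal.
Proof.
move=> fv vU; apply/andP; split.
  have [m [mU _ _]] := lost_universal max_ij.1 (minor_refl _).
  by apply/set0Pn; exists m.
apply/forall_inP=> m mU.
have vm : v != m by apply: contraNneq vU => ->.
have [||m' [m'U m'm lost]] := @lost_universal m v.
- by rewrite Ess2_set2 universal_Ess // fv eq_sym.
- exact: minor_universal.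
by apply/exists_inP; exists m'; rewrite ?m'm.
Qed.

Lemma Ess_sub_universal : Ess f \subset universal.
Proof.
apply/subsetP=> v fv; apply/negPn/negP=> vU.
have [k [l [kU lU kl keep]]] :=
  loss_closed_identify vU (loss_closed_universal fv vU).
have [||m [mU mk lost]] := @lost_universal k l.
- by rewrite Ess2_set2 !universal_Ess.
- exact: minor_universal.
case/negP: lost; apply: (subsetP keep).
rewrite in_setD in_set2 negb_or mk universal_Ess // andbT.
by apply: contraNneq vU => <-.
Qed.

Lemma maximal_deficient_equiv k l : [set k; l] \in Ess2 f ->
  minor_equiv (identify f i j) (identify f k l).
Proof.
move=> kl; have := kl; rewrite Ess2_set2 => /and3P[fk _ _].
have le_kl : minor (identify f i j) (identify f k l).
  exact/minor_universal/(subsetP Ess_sub_universal).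
by rewrite /minor_equiv le_kl; case: max_ij => _; apply.
Qed.

End MaximalIdentification.

Lemma gap_spec n (f : boolfun n) d : gap_values f d ->
  gap_values f (gap f) /\ gap f <= d.
Proof.
move=> fd; rewrite /gap; case: classical_sets.xgetP => [e _ [fe min_e]|no_min].
  by split=> //; apply: min_e.
have ex_value : exists e, boolp.asbool (gap_values f e).
  by exists d; apply/boolp.asboolP.
case: (ex_minnP ex_value) => e /boolp.asboolP fe min_e.
by case: (no_min e); split=> // e' fe'; apply/min_e/boolp.asboolP.
Qed.

Section Gap.

Variables (n : nat) (f : boolfun n).
Hypothesis n_gt0 : 0 < n.

Lemma ess_strict_minor_gap m (g : boolfun m) :
  0 < m -> strict_minor g f -> ess g <= ess f - gap f.
Proof.
move=> m_gt0 gf; have [|_ le_gap] := @gap_spec n f (ess f - ess g).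
  by exists m, g.
by rewrite -(subKn (ltnW (strict_minor_ess n_gt0 gf))) leq_sub2l.
Qed.

Lemma ess_identify_gap i j : [set i; j] \in Ess2 f ->
  ess (identify f i j) <= ess f - gap f.
Proof. by move=> ij; rewrite ess_strict_minor_gap // identify_strict. Qed.

Lemma gap_attained : 1 < ess f ->
  exists i j, [set i; j] \in Ess2 f /\ ess (identify f i j) = ess f - gap f.
Proof.
case/ess_gt1P=> k [l kl].
have [|[m [g [_ gf gapE]]] _] := @gap_spec n f (ess f - ess (identify f k l)).
  by exists n, (identify f k l); rewrite identify_strict.
have [i [j [ij le_g]]] := strict_minor_identify n_gt0 gf.
exists i, j; split=> //; apply/eqP; rewrite eqn_leq ess_identify_gap // gapE.
by rewrite subKn ?(ltnW (strict_minor_ess _ gf)) // ess_minor.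
Qed.

Lemma gap_gt0_ess : 0 < gap f -> 1 < ess f.
Proof.
rewrite /gap; case: classical_sets.xgetP => // _ -> [[m [g [_ gf _]]] _] _.
have [i [j [ij _]]] := strict_minor_identify n_gt0 gf.
by apply/ess_gt1P; exists i, j.
Qed.

End Gap.

Definition greatest_identify n (f : boolfun n) i j :=
  [set i; j] \in Ess2 f /\ forall k l, [set k; l] \in Ess2 f ->
    minor (identify f k l) (identify f i j).

Lemma join_irreducibleP n (f : boolfun n) : 0 < n ->
  join_irreducible f <-> exists i j, greatest_identify f i j.
Proof.
move=> n_gt0; split=> [[m [f' [m_gt0 f'f lower]]]|[i [j [ij le_ij]]]].
  have [i [j [ij le_f']]] := strict_minor_identify n_gt0 f'f.
  exists i, j; split=> // k l kl; apply: minor_trans le_f'.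
  by apply: lower; rewrite ?identify_strict.
exists n, (identify f i j); split; rewrite ?identify_strict // => m g _ gf.
have [k [l [kl le_g]]] := strict_minor_identify n_gt0 gf.
exact: minor_trans le_g (le_ij _ _ kl).
Qed.

Section PairClasses.

Variables (n : nat) (f : boolfun n).

Lemma approx_set2 i j k l : approx f [set i; j] [set k; l] =
  minor_equiv (identify f i j) (identify f k l).
Proof.
apply/idP/idP => [|ij_kl]; last first.
  apply/existsP; exists i; apply/existsP; exists j.
  by apply/existsP; exists k; apply/existsP; exists l; rewrite !eqxx.
case/existsP=> i' /existsP[j' /existsP[k' /existsP[l' /and3P[]]]].
move=> /eqP/(identify_set2 f) ij /eqP/(identify_set2 f) kl ij_kl'.
by rewrite (minor_equiv_trans ij) ?(minor_equiv_trans ij_kl') 1?minor_equiv_sym.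
Qed.

Lemma Cset_set2 i j : ([set i; j] \in Cset f) =
  ([set i; j] \in Ess2 f) && (ess (identify f i j) == ess f - gap f).
Proof.
rewrite [LHS]inE; congr andb; apply/idP/idP => [|ess_ij]; last first.
  by apply/existsP; exists i; apply/existsP; exists j; rewrite eqxx.
case/existsP=> k /existsP[l /andP[/eqP/(identify_set2 f)]].
by move/minor_equiv_ess->.
Qed.

Lemma Cset_eq_class i j :
  (forall k l, [set k; l] \in Ess2 f ->
     (ess (identify f k l) == ess f - gap f) =
     minor_equiv (identify f i j) (identify f k l)) <->
  Cset f = [set p in Ess2 f | approx f [set i; j] p].
Proof.
split=> [classE|classE k l kl].
  apply/setP=> p; rewrite [RHS]inE; have [|pN] := boolP (p \in Ess2 f).
    case/Ess2P=> k [l [-> kl]]; rewrite Cset_set2 kl classE //.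
    by rewrite approx_set2.
  by apply: contraNF pN; rewrite inE => /andP[].
by rewrite -approx_set2 -[LHS](andb_idl (fun _ => kl)) -Cset_set2 classE inE kl.
Qed.

Hypothesis n_gt0 : 0 < n.

Lemma greatest_identify_Cset i j : greatest_identify f i j ->
  Cset f = [set p in Ess2 f | approx f [set i; j] p].
Proof.
move=> [ij le_ij]; have f_gt1 : 1 < ess f by apply/ess_gt1P; exists i, j.
have ess_ij : ess (identify f i j) = ess f - gap f.
  have [k [l [kl ess_kl]]] := gap_attained n_gt0 f_gt1.
  by apply/eqP; rewrite eqn_leq ess_identify_gap //= -ess_kl ess_minor ?le_ij.
apply/Cset_eq_class=> k l kl; rewrite -ess_ij.
apply/eqP/idP => [ess_kl|/minor_equiv_ess //].
by rewrite /minor_equiv le_ij // minor_ess_ge ?le_ij ?ess_kl.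
Qed.

Lemma Cset_class_greatest_identify i j : [set i; j] \in Ess2 f ->
  Cset f = [set p in Ess2 f | approx f [set i; j] p] ->
  greatest_identify f i j.
Proof.
move=> ij /Cset_eq_class classE; split=> // k l kl.
have /eqP ess_ij : ess (identify f i j) == ess f - gap f.
  by rewrite classE // /minor_equiv minor_refl.
have lt_ij : ess (identify f i j) < ess f.
  by rewrite strict_minor_ess // identify_strict.
have [k' [l' [max_kl' le_kl]]] := exists_maximal_identify kl.
have kl' := max_kl'.1; apply: minor_trans le_kl _.
have [deficient|full] := ltnP (ess (identify f k' l')).+1 (ess f).
  by have /andP[] := maximal_deficient_equiv max_kl' deficient ij.
have : minor_equiv (identify f i j) (identify f k' l').
  rewrite -classE // eqn_leq ess_identify_gap //= -ess_ij -ltnS.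
  exact: leq_trans lt_ij full.
by case/andP.
Qed.

Lemma gap_gt1_identify_equiv : 1 < gap f ->
  exists i j, [set i; j] \in Ess2 f /\
    forall k l, [set k; l] \in Ess2 f ->
      minor_equiv (identify f i j) (identify f k l).
Proof.
move=> gap_gt1; have f_gt1 := gap_gt0_ess n_gt0 (ltnW gap_gt1).
have /ess_gt1P[k [l /exists_maximal_identify[i [j [max_ij _]]]]] := f_gt1.
exists i, j; split=> [|k' l' kl']; first exact: max_ij.1.
apply: maximal_deficient_equiv kl' => //.
have : ess (identify f i j) < ess f - 1.
  apply: leq_ltn_trans (ess_identify_gap n_gt0 max_ij.1) _.
  by rewrite ltn_sub2l // ltnW.
by rewrite ltn_subRL add1n.
Qed.

End PairClasses.

Theorem theorem2p15 (n : nat) (f : boolfun n) (n_gt0 : 0 < n) :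
  (join_irreducible f <->
     2 <= ess f /\ Cset f \in equivalence_partition (approx f) (Ess2 f)) /\
  (gap f = 2 -> join_irreducible f /\ Cset f = Ess2 f).
Proof.
split; [split|].
- case/(join_irreducibleP f n_gt0)=> i [j ij_max].
  split; first by apply/ess_gt1P; exists i, j; apply: ij_max.1.
  apply/imsetP; exists [set i; j]; first exact: ij_max.1.
  exact: greatest_identify_Cset.
- case=> _ /imsetP[_ /Ess2P[i [j [-> ij]]] classE].
  apply/join_irreducibleP=> //; exists i, j.
  exact: Cset_class_greatest_identify.
- move=> gap2; have [|i [j [ij equiv]]] := @gap_gt1_identify_equiv n f n_gt0.
    by rewrite gap2.
  have ij_max : greatest_identify f i j.
    by split=> // k l /equiv/andP[].
  split; first by apply/join_irreducibleP=> //; exists i, j.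
  rewrite (greatest_identify_Cset n_gt0 ij_max).
  apply/setP=> p; rewrite inE; apply: andb_idr => /Ess2P[k [l [-> kl]]].
  by rewrite approx_set2 equiv.
Qed.
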